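(* Let $n,m\ge 1$ be integers. The map $\Phi:\pi\mapsto D=(d_{i\ell})_{1\le i\le n,\,1\le \ell\le m}$, where $d_{i\ell}=|\{j : \pi_{i j}=\ell>\pi_{i+1\,j}\}|$, defines a bijection between the set $\mathrm{PP}(\infty,n,m)$ of plane partitions with at most $n$ rows and entries not exceeding $m$, and the set of $n\times m$ matrices ($n$ rows, $m$ columns) with nonnegative integer entries.
   Context: A plane partition $\pi=(\pi_{ij})_{i,j\ge1}$ is a two-dimensional array of nonnegative integers with finitely many nonzero entries such that $\pi_{ij}\ge\pi_{i+1\,j}$ and $\pi_{ij}\ge\pi_{i\,j+1}$ for all $i,j\ge1$. Here $i$ is the row index and $j$ the column index; zero entries are ignored, so $\pi$ has at most $n$ rows if $\pi_{ij}=0$ for all $i>n$. $\mathrm{PP}(\infty,n,m)$ is the set of plane partitions with at most $n$ (nonzero) rows and all entries at most $m$; the number of columns is not restricted. *)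

(* Defs.v *)
From mathcomp Require Import all_boot all_algebra finmap.
From mathcomp Require Import boolp classical_sets functions cardinality.

Set Implicit Arguments.
Unset Strict Implicit.
Unset Printing Implicit Defensive.

Local Open Scope classical_set_scope.

(* Row and column indices are shifted to start at 0: [p i j] is the entry in   *)
(* row i + 1 and column j + 1.                                                *)
Definition plane_partition (p : nat -> nat -> nat) : Prop :=
  [/\ finite_set [set ij : nat * nat | p ij.1 ij.2 <> 0],
      forall i j, p i.+1 j <= p i j
    & forall i j, p i j.+1 <= p i j].

(* PP(oo, n, m): no restriction on the number of columns.                     *)
Definition PP (n m : nat) : set (nat -> nat -> nat) :=
  [set p | [/\ plane_partition p,
               forall i j, n <= i -> p i j = 0
             & forall i j, p i j <= m]].

(* The column index l : 'I_m of the matrix stands for the entry value l + 1,  *)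
(* which is nonzero, so that the set counted below is finite when p is a      *)
(* plane partition ([fset_set] returns the empty set on infinite sets).       *)
Definition Phi (n m : nat) (p : nat -> nat -> nat) : 'M[nat]_(n, m) :=
  \matrix_(i < n, l < m)
    #|` fset_set [set j : nat | p i j = l.+1 /\ p i.+1 j < l.+1] |%fset.

(* Main.v *)
Require Import Defs.
From mathcomp Require Import all_boot all_algebra finmap.
From mathcomp Require Import boolp classical_sets functions cardinality.

(* Let [c i l] be the number of entries of row [i] of a plane partition that
   exceed [l], so that [l < p i j] iff [j < c i l]: rows and their conjugates
   determine each other.  The columns counted by the entry [(i, l)] of [Phi p]
   are those in the interval [max (c i (l+1)) (c (i+1) l) <= j < c i l], so that
   [c] satisfies the last-passage percolation recursion
   [c i l = D i l + max (c i (l+1)) (c (i+1) l)] with zero boundary values for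
   [n <= i] or [m <= l].  The recursion has exactly one solution for each [D]. *)

Set Implicit Arguments.
Unset Strict Implicit.
Unset Printing Implicit Defensive.

Local Open Scope classical_set_scope.

Lemma antitone_leq (f : nat -> nat) :
  (forall k, f k.+1 <= f k) -> forall a b, a <= b -> f b <= f a.
Proof.
move=> fS a b /subnKC <-; elim: (b - a) => [|k IHk]; first by rewrite addn0.
by rewrite addnS (leq_trans (fS _)).
Qed.

(** [g j] is the least [l] with [f l <= j]; it exists by the second hypothesis, and antitonicity
    makes every larger [l] satisfy the inequality too. It serves to pass from rows to conjugates and
    back. *)
Lemma conjugate_ex (f : nat -> nat) :
    (forall k, f k.+1 <= f k) -> (forall j, exists l, f l <= j) ->
  exists g : nat -> nat, forall l j, (l < g j) = (j < f l).
Proof.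
move=> fS f_small; exists (fun j => ex_minn (f_small j)) => l j.
case: ex_minnP => k fk_le k_min; apply/idP/idP; last first.
  rewrite !ltnNge; apply: contra => le_kl.
  exact: leq_trans (antitone_leq fS le_kl) fk_le.
by rewrite !ltnNge; apply: contra => /k_min.
Qed.

Lemma ltn_ext (a b : nat) : (forall l, (l < a) = (l < b)) -> a = b.
Proof.
move=> ab; apply/eqP; rewrite eqn_leq (leqNgt a) (leqNgt b).
by rewrite ab ltnn -ab ltnn.
Qed.

Definition is_conjugate (p c : nat -> nat -> nat) :=
  forall i l j, (l < p i j) = (j < c i l).

Lemma plane_partition_conjugate (p : nat -> nat -> nat) :
  plane_partition p -> exists c, is_conjugate p c.
Proof.
case=> finp _ pS.
have p_small i l : exists j, p i j <= l.
  (* Otherwise row [i] would be nonzero in every column, and projecting the finite support to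
     columns would make [nat] finite. *)
  apply: contrapT => /forallNP p_gt.
  apply: infinite_nat.
  apply: (@sub_finite_set _ _ (snd @` [set ij : nat * nat | p ij.1 ij.2 <> 0])).
    move=> j _; exists (i, j) => //= pij0.
    by apply: (p_gt j); rewrite pij0.
  exact: finite_image.
have row_conj i : exists ci : nat -> nat,
    forall j l, (j < ci l) = (l < p i j).
  exact: conjugate_ex (pS i) (p_small i).
have [c cP] := choice row_conj.
by exists c => i l j; rewrite cP.
Qed.

Lemma card_fset_set_interval (a b : nat) :
  #|` fset_set [set j | a <= j < b] |%fset = b - a.
Proof.
have -> : [set j | a <= j < b] = [set` [fset j in index_iota a b]%fset].
  by apply/seteqP; split=> j /=; rewrite inE /= mem_index_iota.
by rewrite set_fsetK card_fseq undup_id ?iota_uniq // size_iota.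
Qed.

Lemma Phi_conjugate (n m : nat) (p c : nat -> nat -> nat) :
    is_conjugate p c -> forall (i : 'I_n) (l : 'I_m),
  Phi n m p i l = c i l - maxn (c i l.+1) (c i.+1 l).
Proof.
move=> pc i l; rewrite mxE -card_fset_set_interval.
congr (#|` fset_set _ |%fset); apply/seteqP.
split=> j /=; rewrite geq_max -pc !(leqNgt (c _ _)) -!pc -!leqNgt.
  by case=> -> pi1j_lt; rewrite !leqnn andbT.
case/andP=> /andP[pij_le pi1j_le] pij_gt.
by split=> //; apply/eqP; rewrite eqn_leq pij_le.
Qed.

Section LastPassage.
Variables (n m : nat) (d : nat -> nat -> nat).

Definition last_passage (c : nat -> nat -> nat) :=
  (forall i l, n <= i \/ m <= l -> c i l = 0) /\
  (forall i l, i < n -> l < m ->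
     c i l = d i l + maxn (c i l.+1) (c i.+1 l)).

Lemma last_passage_uniq (c c' : nat -> nat -> nat) :
  last_passage c -> last_passage c' -> forall i l, c i l = c' i l.
Proof.
move=> [c0 cE] [c'0 c'E] i l.
(* Inside the rectangle this distance to the zero boundary drops by one at both neighbours. *)
have [k] := ubnP ((n - i) + (m - l)).
elim: k i l => // k IHk i l; rewrite ltnS => lek.
have [le_ni|lt_in] := leqP n i; first by rewrite c0 ?c'0; auto.
have [le_ml|lt_lm] := leqP m l; first by rewrite c0 ?c'0; auto.
rewrite cE // c'E // !IHk //; apply: leq_trans lek.
  by rewrite ltn_add2r ltn_sub2l.
by rewrite ltn_add2l ltn_sub2l.
Qed.

(** [k] is fuel that makes the recursion structural; [(n - i) + (m - l)] is enough. *)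
Fixpoint last_passage_rec (k i l : nat) : nat :=
  if k is k'.+1 then
    if (i < n) && (l < m) then
      d i l + maxn (last_passage_rec k' i l.+1) (last_passage_rec k' i.+1 l)
    else 0
  else 0.

Lemma last_passage_ex : exists c, last_passage c.
Proof.
exists (fun i l => last_passage_rec ((n - i) + (m - l)) i l); split=> i l.
  by case: (_ + _) => //= k [] /leq_gtF ->; rewrite ?andbF.
move=> lt_in lt_lm.
(* Both neighbours need the same fuel, so one unfolding step serves both. *)
have -> : n - i + (m - l.+1) = n - i.+1 + (m - l).
  by rewrite -(subnSK lt_in) -(subnSK lt_lm) addSn addnS.
by rewrite -{1}(subnSK lt_in) addSn [LHS]/= lt_in lt_lm.
Qed.

Lemma last_passage_antitone c :
  last_passage c -> forall i l, c i l.+1 <= c i l /\ c i.+1 l <= c i l.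
Proof.
move=> [c0 cE] i l.
have [le_ni|lt_in] := leqP n i.
  by rewrite !c0; auto; left; apply: leqW.
have [le_ml|lt_lm] := leqP m l.
  by rewrite !c0; auto; right; apply: leqW.
by rewrite (cE i l) //; split;
  rewrite (leq_trans _ (leq_addl _ _)) ?leq_maxl ?leq_maxr.
Qed.

End LastPassage.

Lemma PP_last_passage (n m : nat) (d p c : nat -> nat -> nat) :
    PP n m p -> is_conjugate p c ->
    (forall (i : 'I_n) (l : 'I_m), Phi n m p i l = d i l) ->
  last_passage n m d c.
Proof.
move=> [[_ pSr pSc] p0 p_le] pc dE; split=> [i l il|i l lt_in lt_lm].
  apply: ltn_ext => j; rewrite -pc ltn0 ltnNge.
  by case: il => [/p0->//|le_ml]; rewrite (leq_trans (p_le _ _) le_ml).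
(* The truncated subtraction is exact once [c i l] dominates both neighbours: the right one by
   conjugacy alone, the lower one because columns of [p] decrease. *)
rewrite -(dE (Ordinal lt_in) (Ordinal lt_lm)) (Phi_conjugate pc) /= subnK //.
rewrite geq_max; apply/andP; split; rewrite leqNgt.
  by rewrite -pc -leqNgt leqW // leqNgt pc ltnn.
by rewrite -pc -leqNgt (leq_trans (pSr _ _)) // leqNgt pc ltnn.
Qed.

(** Antitonicity of [c] in [l] allows conjugating its rows into those of [p]; antitonicity in [i]
    makes the columns of [p] decrease. *)
Lemma last_passage_PP (n m : nat) (d c : nat -> nat -> nat) :
  last_passage n m d c -> exists2 p, PP n m p & is_conjugate p c.
Proof.
move=> lpc; have c_anti := last_passage_antitone lpc; have [c0 _] := lpc.
have row_conj i : exists pi : nat -> nat,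
    forall l j, (l < pi j) = (j < c i l).
  apply: conjugate_ex => [l|j]; first by case: (c_anti i l).
  by exists m; rewrite c0 //; right.
have [p pc] := choice row_conj.
have p0 i j : n <= i -> p i j = 0.
  by move=> le_ni; apply: ltn_ext => l; rewrite pc c0 //; left.
exists p => //; split=> // [|i j]; last by rewrite leqNgt pc c0 //; right.
split=> [|i j|i j].
(* A nonzero [p i j] forces [j < c i 0 <= c 0 0]. *)
- apply: (@sub_finite_set _ _ (`I_n `*` `I_(c 0 0))); last first.
    exact: finite_setX.
  move=> [i j] /= /eqP; rewrite -lt0n => p_gt0; split=> /=.
    by rewrite ltnNge; apply/negP => /p0 pij; rewrite pij in p_gt0.
  rewrite pc in p_gt0; apply: leq_trans p_gt0 _.
  by apply: (@antitone_leq (c^~ 0)) => // k; case: (c_anti k 0).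
- rewrite leqNgt pc -leqNgt; case: (c_anti i (p i j)) => _ /leq_trans-> //.
  by rewrite leqNgt -pc ltnn.
- by rewrite leqNgt pc -leqNgt leqW // leqNgt -pc ltnn.
Qed.

Theorem theorem3p2 (n m : nat) (hn : 1 <= n) (hm : 1 <= m) :
  set_bij (PP n m) [set: 'M[nat]_(n, m)]%classic (@Phi n m).
Proof.
split=> // [p q /set_mem PPp /set_mem PPq Phi_pq|D _].
  have [c pc] : exists c, is_conjugate p c.
    by case: PPp => /plane_partition_conjugate.
  have [c' qc'] : exists c, is_conjugate q c.
    by case: PPq => /plane_partition_conjugate.
  pose d i l := c i l - maxn (c i l.+1) (c i.+1 l).
  have dE := Phi_conjugate pc : forall i l, Phi n m p i l = d i l.
  have lpc := PP_last_passage PPp pc dE.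
  (* Equal images mean that [c] and [c'] solve the recursion for the same [d]. *)
  rewrite Phi_pq in dE; have lpc' := PP_last_passage PPq qc' dE.
  apply/funext => i; apply/funext => j; apply: ltn_ext => l.
  by rewrite pc qc' (last_passage_uniq lpc lpc').
(* [D] extended by zero to all pairs of naturals. *)
pose d i l := if (insub i, insub l) is (Some i', Some l') then D i' l' else 0.
have [c lpc] := last_passage_ex n m d.
have [p PPp pc] := last_passage_PP lpc; exists p => //.
apply/matrixP => i l; rewrite (Phi_conjugate pc); have [_ ->] := lpc => //.
by rewrite addnK /d !valK.
Qed.
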